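(* Let $j\ge 1$ be an integer and $x>0$. Let $A_j(x)$ be the perturbation of the Agler shift $A_j$ in which the zeroth weight $\sqrt{\frac{1}{j}}$ is replaced by $\sqrt{\frac{x}{j}}$ (all other weights unchanged), and let $k\in\mathbb{N}$ and $m\in\{0,1,\ldots,k\}$. (i) $A_j(x)$ is $(k,2m)$-PD if and only if $x\le p(j,k,m)$, where $$p(j,k,m)=\frac{(k+1-m)(j+k+m-1)}{k^2+jk+2m-jm-m^2}=\frac{(j+k+m)(k-m)+2m+j-1}{(j+k+m)(k-m)+2m}.$$ (ii) $A_j(x)$ is $(k,2m)$-PD if and only if $A_j(x)$ is $\big((j+k+m)(k-m)+2m\big)$-contractive.
   Context: Weighted shifts: given a bounded sequence $\alpha=(\alpha_n)_{n=0}^\infty$ of positive real numbers, $W_\alpha$ is the bounded operator on $\ell^2(\mathbb{N}_0)$ with $W_\alpha e_n=\alpha_n e_{n+1}$. Its moment sequence $\gamma$ is $\gamma_0:=1$, $\gamma_n:=\prod_{i=0}^{n-1}\alpha_i^2$ for $n\ge1$. For $j=1,2,\ldots$, the Agler shift $A_j$ is the weighted shift with weights $\sqrt{\frac{n+1}{n+j}}$, $n=0,1,\ldots$. For a real sequence $a$, $(\nabla a)_n:=a_n-a_{n+1}$, $\nabla^0 a:=a$, $\nabla^{n}:=\nabla\circ\nabla^{n-1}$. For integers $i,r\ge 0$, $M_a(i,r):=(a_{i+s+t})_{s,t=0}^{r}$, the $(r+1)\times(r+1)$ Hankel matrix. ''Positive definite'' means positive semi-definite. For integers $k\ge1$ and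 $0\le m\le k$, a weighted shift with moment sequence $\gamma$ is $(k,2m)$-PD if, for every $i\ge 0$, the matrix $M_{\nabla^{2m}(\gamma)}(i,k-m)$ is positive definite. For $n\ge1$, it is $n$-contractive if $\sum_{i=0}^n(-1)^i\binom{n}{i}\gamma_{\ell+i}\ge 0$ for all $\ell\ge 0$. *)

(* Defs.v *)
From mathcomp Require Import all_boot all_order all_algebra.
From mathcomp Require Import all_classical all_reals all_analysis.

Set Implicit Arguments.
Unset Strict Implicit.
Unset Printing Implicit Defensive.

Import Order.TTheory GRing.Theory Num.Theory.
Import numFieldNormedType.Exports.

Local Open Scope classical_set_scope.
Local Open Scope ring_scope.

(* A weighted shift W_a on l^2(N_0), W_a e_n = a_n e_(n+1), is represented by
   its bounded sequence of positive weights, which determines it. *)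
Record weighted_shift (R : realType) := WeightedShift {
  weight :> nat -> R;
  weight_gt0 : forall n, 0 < weight n;
  weight_bounded : bounded_fun weight }.

Section WeightedShifts.
Variable R : realType.
Implicit Types (a : nat -> R) (W : weighted_shift R).

Definition moment W (n : nat) : R := \prod_(i < n) W i ^+ 2.

Definition nabla a (n : nat) : R := a n - a n.+1.

Definition hankel a (i r : nat) : 'M[R]_r.+1 :=
  \matrix_(s < r.+1, t < r.+1) a (i + s + t)%N.

Definition possemidefmx n (A : 'M[R]_n) : Prop :=
  A^T = A /\ forall u : 'rV[R]_n, 0 <= (u *m A *m u^T) 0 0.

(* [kPD k m W] is the property (k,2m)-PD: the second argument is m, not 2m. *)
Definition kPD (k m : nat) W : Prop :=
  forall i, possemidefmx (hankel (iter (2 * m) nabla (moment W)) i (k - m)).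

Definition contractive (n : nat) W : Prop :=
  forall l, 0 <= \sum_(i < n.+1) (-1) ^+ i * 'C(n, i)%:R * moment W (l + i).

Definition agler_weight (j n : nat) : R := Num.sqrt (n.+1%:R / (n + j)%:R).

Lemma agler_weight_gt0 j : (1 <= j)%N -> forall n, 0 < agler_weight j n.
Proof.
by move=> j1 n; rewrite sqrtr_gt0 divr_gt0 // ltr0n // addn_gt0 j1 orbT.
Qed.

Lemma agler_weight_bounded j : (1 <= j)%N -> bounded_fun (agler_weight j).
Proof.
move=> j1; exists 1; split; first exact: num_real.
move=> M M1 n _ /=; rewrite ger0_norm ?sqrtr_ge0 //.
apply: le_trans (ltW M1); rewrite -[leRHS]sqrtr1 ler_sqrt //.
rewrite ler_pdivrMr ?mul1r ?ltr0n ?addn_gt0 ?j1 ?orbT //.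
by rewrite ler_nat -addn1 leq_add2l.
Qed.

Definition agler (j : nat) (j1 : (1 <= j)%N) : weighted_shift R :=
  WeightedShift (agler_weight_gt0 j1) (agler_weight_bounded j1).

Definition set_weight0 a (c : R) (n : nat) : R := if n is 0 then c else a n.

Lemma set_weight0_gt0 W c : 0 < c -> forall n, 0 < set_weight0 W c n.
Proof. by move=> c0 [|n] //=; apply: weight_gt0. Qed.

Lemma set_weight0_bounded W c : bounded_fun (set_weight0 W c).
Proof.
have [M [Mr WM]] := weight_bounded W.
exists (Num.max M `|c|); split; first exact: num_real.
move=> N; rewrite gt_max => /andP[MN cN] [|n] _ /=; first exact: ltW.
exact: WM.
Qed.

Definition perturb0 W (c : R) (c0 : 0 < c) : weighted_shift R :=
  WeightedShift (set_weight0_gt0 W c0) (set_weight0_bounded W c).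

Lemma sqrt_div_gt0 j (x : R) : (1 <= j)%N -> 0 < x -> 0 < Num.sqrt (x / j%:R).
Proof. by move=> j1 x0; rewrite sqrtr_gt0 divr_gt0 // ltr0n. Qed.

Definition agler_pert j (x : R) (j1 : (1 <= j)%N) (x0 : 0 < x) :=
  perturb0 (agler j1) (sqrt_div_gt0 j1 x0).

Definition pbound (j k m : nat) : R :=
  (k%:R + 1 - m%:R) * (j%:R + k%:R + m%:R - 1) /
  (k%:R ^+ 2 + j%:R * k%:R + 2 * m%:R - j%:R * m%:R - m%:R ^+ 2).

End WeightedShifts.

(* Main.v *)
(* With d = j - 1 and q = 2m, the q-th difference of the moments is
   x h_n + (1 - x) [n = 0], where h_n is a nonnegative multiple of n! / (n + d + q)!,
   normalised by (d + q) h_0 = d.  Hence q-contractivity only matters at l = 0,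
   where it says x q <= q + d.  Since n! / (n + c)! is a product of Cauchy
   kernels 1 / (n + a), the Hankel matrices H of h are positive semidefinite,
   and so are all Hankel matrices with i >= 1.  For i = 0 and r = k - m, an
   explicit vector w satisfies H w = d e_0 and w_0 = K, where
   K = (r + 1) (r + d + q) > 0.  Evaluating the form x H - (x - 1) e_0 e_0^T at
   w shows that (x - 1) K <= x d is necessary; expanding the form of H at
   u - (u_0 / K) w gives K u^T H u >= d u_0^2, which shows sufficiency. *)
Require Import Defs.
From mathcomp Require Import all_boot all_order all_algebra.
From mathcomp Require Import all_classical all_reals all_analysis.
From mathcomp Require Import ring lra zify.

Set Implicit Arguments.
Unset Strict Implicit.
Unset Printing Implicit Defensive.

Import Order.TTheory GRing.Theory Num.Theory.
Local Open Scope ring_scope.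

(** * Iterated differences of sequences *)

Section FiniteDifferences.
Variable R : realType.
Implicit Types (a b : nat -> R) (p : {poly R}).

Lemma eq_iter_nabla n a b : a =1 b -> iter n (@nabla R) a =1 iter n (@nabla R) b.
Proof. by move=> ab; elim: n => // n IHn i /=; rewrite /nabla !IHn. Qed.

Lemma iter_nablaD n a b i : iter n (@nabla R) (fun k => a k + b k) i =
  iter n (@nabla R) a i + iter n (@nabla R) b i.
Proof. by elim: n i => // n IHn i /=; rewrite /nabla !IHn; ring. Qed.

Lemma iter_nablaZ n c a i :
  iter n (@nabla R) (fun k => c * a k) i = c * iter n (@nabla R) a i.
Proof. by elim: n i => // n IHn i /=; rewrite /nabla !IHn; ring. Qed.

(** Turns n-contractivity into nonnegativity of the n-th difference of the moments; the induction
    step is Pascal's rule. *)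
Lemma iter_nablaE n a l : iter n (@nabla R) a l =
  \sum_(i < n.+1) (-1) ^+ i * 'C(n, i)%:R * a (l + i)%N.
Proof.
elim: n a l => [|n IHn] a l.
  by rewrite big_ord1 bin0 expr0 !mul1r addn0.
rewrite iterS {1}/nabla !IHn.
rewrite big_ord_recl [RHS]big_ord_recl /= !bin0 -!addrA; congr (_ + _).
under [in RHS]eq_bigr do rewrite /bump /= add1n binS natrD mulrDr mulrDl.
rewrite big_split /=; congr (_ + _).
  rewrite big_ord_recr /= bin_small // mulr0 mul0r addr0.
  by apply: eq_bigr => i _; rewrite /bump /= add1n.
rewrite -sumrN; apply: eq_bigr => i _.
by rewrite exprS addnS addSn; ring.
Qed.

(** Each difference lowers the degree, because [p] and its translate p(X + 1) have the same size and
    the same leading coefficient. *)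
Lemma iter_nabla_poly n p :
  (size p <= n)%N -> iter n (@nabla R) (fun t => p.[t%:R]) =1 fun=> 0.
Proof.
elim: n p => [|n IHn] p sp i.
  by move: sp; rewrite leqn0 size_poly_eq0 => /eqP ->; exact: horner0.
rewrite iterSr; set q := p \Po ('X + 1%:P).
rewrite (_ : iter _ _ _ _ = iter n (@nabla R) (fun t => (p - q).[t%:R]) i); last first.
  apply: eq_iter_nabla => t.
  by rewrite /nabla hornerD hornerN horner_comp !hornerE natr1.
apply: IHn; apply/leq_sizeP => l nl.
have sX : size ('X + 1%:P : {poly R}) = 2%N by rewrite size_XaddC.
have sq : size q = size p by rewrite size_comp_poly2.
rewrite coefB; have [pl|lp] := leqP (size p) l; first by rewrite !nth_default ?sq ?subrr.
have pl : l = (size p).-1 by lia.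
have := lead_coef_comp p (q := 'X + 1%:P); rewrite sX => /(_ isT).
rewrite lead_coefXaddC expr1n mulr1 /lead_coef -/q sq -pl => ->.
by rewrite subrr.
Qed.

End FiniteDifferences.

(** * The ratios n! / (n + c)! and the solution of their Hankel system *)

Section ShiftedFactorials.
Variable R : realType.

(** For c = j - 1 these are the moments of A_j up to the factor (j - 1)!. For c >= 1 they are the
    moments of (1 - t)^(c-1) / (c - 1)! on [0, 1]. *)
Definition ratf (c n : nat) : R := n`!%:R / (n + c)`!%:R.

(** The Pochhammer symbol c (c + 1) ... (c + n - 1). *)
Definition rise (c n : nat) : R := \prod_(i < n) (c + i)%:R.

Lemma factr_neq0 n : n`!%:R != 0 :> R.
Proof. by rewrite pnatr_eq0 -lt0n fact_gt0. Qed.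

Lemma ratfS c n :
  ratf c n.+1 = n.+1%:R / (n + c).+1%:R * ratf c n.
Proof.
rewrite /ratf addSn !factS !natrM.
have := factr_neq0 (n + c); have : (n + c).+1%:R != 0 :> R by rewrite pnatr_eq0.
by move=> ? ?; field; apply/andP.
Qed.

Lemma nabla_ratf c n : nabla (ratf c) n = c%:R * ratf c.+1 n.
Proof.
rewrite /nabla /ratf addnS addSn !factS !natrM -!natr1 natrD.
have := factr_neq0 (n + c); have : (n + c).+1%:R != 0 :> R by rewrite pnatr_eq0.
rewrite -natr1 natrD => ? ?; field; exact/andP.
Qed.

Lemma iter_nabla_ratf q c n :
  iter q (@nabla R) (ratf c) n = rise c q * ratf (c + q) n.
Proof.
elim: q n => [|q IHq] n; first by rewrite /rise big_ord0 mul1r addn0.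
rewrite iterS {1}/nabla !IHq -mulrBr -/(nabla (ratf (c + q)) n) nabla_ratf.
by rewrite /rise big_ord_recr /= addnS mulrA.
Qed.

(** Stated without dividing by (c - 1)!, so that c = 0 is covered. *)
Lemma fact_rise c n : c`!%:R * rise c n * (c + n)%:R = c%:R * (c + n)`!%:R.
Proof.
elim: n => [|n IHn]; first by rewrite /rise big_ord0 addn0 mulr1 mulrC.
rewrite /rise big_ord_recr /= -/(rise c n) !mulrA IHn addnS factS natrM; ring.
Qed.

Lemma rise_ge0 c n : 0 <= rise c n.
Proof. by apply: prodr_ge0 => i _; apply: ler0n. Qed.

(** The polynomial whose value at a natural number t is (c + n + t)! / (c + t)!. *)
Definition risep (c n : nat) : {poly R} := \prod_(i < n) ('X + (c + i).+1%:R%:P).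

Lemma size_risep c n : size (risep c n) = n.+1.
Proof.
elim: n => [|n IHn]; first by rewrite /risep big_ord0 size_poly1.
rewrite /risep big_ord_recr /= -/(risep c n) size_mul ?IHn ?size_XaddC ?addn2 //.
  by rewrite -size_poly_eq0 IHn.
by rewrite -size_poly_eq0 size_XaddC.
Qed.

Lemma risep_fact c n t : (risep c n).[t%:R] * (c + t)`!%:R = (c + n + t)`!%:R.
Proof.
elim: n => [|n IHn]; first by rewrite /risep big_ord0 hornerE mul1r addn0.
rewrite /risep big_ord_recr /= hornerM -/(risep c n) mulrAC IHn !hornerE.
by rewrite addnS addSn factS natrM mulrC -natrD; congr (_%:R * _); lia.
Qed.

Lemma risepN1 c n : (risep c n).[-1] = rise c n.
Proof.
rewrite /risep horner_prod; apply: eq_bigr => i _.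
by rewrite !hornerE -natr1; ring.
Qed.

(* [repw c r] is [p(0) * p(t)], expanded in monomials, summed over the first
   [r.+1] orthonormal polynomials [p] of the Jacobi weight [(1 - t) ^ (c - 1)]
   on [0, 1]; the resulting formula also makes sense for [c = 0]. *)
Definition repw (c r t : nat) : R :=
  r.+1%:R * (r + c)%:R * ((-1) ^+ t * 'C(r, t)%:R) *
  ((c + r + t)`!%:R / ((c + r)`!%:R * t.+1`!%:R)).

Lemma repw0 c r : repw c r 0 = r.+1%:R * (r + c)%:R.
Proof.
rewrite /repw bin0 expr0 (factS 0) fact0 !mulr1 addn0 divff ?mulr1 ?factr_neq0 //.
Qed.

Lemma iter_nabla_inv r : iter r (@nabla R) (fun t => t.+1%:R^-1) 0 = r.+1%:R^-1.
Proof.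
rewrite (@eq_iter_nabla _ _ _ (ratf 1)); last first.
  move=> t; rewrite /ratf addn1 factS natrM invfM mulrCA divff ?factr_neq0 ?mulr1 //.
rewrite iter_nabla_ratf; have := fact_rise 1 r.
rewrite /ratf (factS 0) fact0 add0n !mul1r add1n => E.
have := factr_neq0 r.+1; have r0 : r.+1%:R != 0 :> R by rewrite pnatr_eq0.
by move=> f0; apply: (mulIf r0); rewrite mulVf // mulrAC E divff.
Qed.

(** The signed binomials in [repw] make the sum a multiple of the r-th difference at 0 of the
    sequence [F], which is polynomial in t up to a multiple of 1 / (t + 1). *)
Lemma repw_ratf c r s : (s <= r)%N ->
  \sum_(t < r.+1) repw c r t * ratf c (s + t) =
  (s == 0%N)%:R * ((r + c)%:R * rise c r / (c + r)`!%:R).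
Proof.
move=> sr.
pose F t : R := (c + r + t)`!%:R / t.+1`!%:R * ratf c (s + t).
transitivity (r.+1%:R * (r + c)%:R / (c + r)`!%:R * iter r (@nabla R) F 0).
  rewrite iter_nablaE mulr_sumr; apply: eq_bigr => t _.
  by rewrite /F /repw add0n invfM; ring.
(* For s > 0, [F] is a polynomial of degree (r - s) + (s - 1) = r - 1, so its r-th difference
   vanishes. *)
case: s sr @F => [|s] sr F; last first.
  rewrite mul0r (@eq_iter_nabla _ _ _
    (fun t => (risep (s.+1 + c) (r - s.+1) * risep 1 s).[t%:R])); last first.
    move=> t; rewrite hornerM /F /ratf.
    have := risep_fact (s.+1 + c) (r - s.+1) t; have := risep_fact 1 s t.
    rewrite (_ : 1 + s + t = s.+1 + t)%N // => <-.
    rewrite (_ : s.+1 + c + (r - s.+1) + t = c + r + t)%N; last by lia.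
    move=> <-; rewrite (_ : s.+1 + t + c = s.+1 + c + t)%N; last by lia.
    rewrite add1n; have := factr_neq0 t.+1; have := factr_neq0 (s.+1 + c + t).
    by move=> ? ?; field; apply/andP.
  rewrite iter_nabla_poly ?mulr0 //.
  rewrite size_mul -?size_poly_eq0 ?size_risep //; lia.
rewrite mul1r.
(* For s = 0, [F] is [risep c r] divided by X + 1. The remainder is the value at -1, namely
   [rise c r], and the quotient [Q] has degree below r. *)
have : root (risep c r - (rise c r)%:P) (-1) by rewrite rootE !hornerE risepN1 subrr.
move=> /factor_theorem [Q QE].
have sQ : (size Q <= r)%N.
  have [->|Q0] := eqVneq Q 0; first by rewrite size_poly0.
  have : (size (Q * ('X - (-1)%:P))%R <= r.+1)%N.
    rewrite -QE (leq_trans (size_polyD _ _)) // geq_max size_risep leqnn.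
    by rewrite size_polyN (leq_trans (size_polyC_leq1 _)).
  by rewrite size_Mmonic ?monicXsubC // size_XsubC addn2.
rewrite (@eq_iter_nabla _ _ _ (fun t => rise c r * t.+1%:R^-1 + Q.[t%:R])); last first.
  move=> t.
  have := congr1 (fun p => p.[t%:R]) QE; rewrite !hornerE => {}QE.
  rewrite /F /ratf add0n.
  rewrite -(risep_fact c r t).
  rewrite (addnC c t).
  have -> : (risep c r).[t%:R] = rise c r + Q.[t%:R] * (t%:R + 1).
    by apply/eqP; rewrite addrC -subr_eq QE opprK.
  rewrite factS natrM -natr1.
  have := factr_neq0 (t + c); have := factr_neq0 t.
  have : t.+1%:R != 0 :> R by rewrite pnatr_eq0.
  by rewrite -natr1 => ? ? ?; field; apply/and3P.
rewrite iter_nablaD iter_nablaZ iter_nabla_inv iter_nabla_poly // addr0.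
have := factr_neq0 (c + r); have : r.+1%:R != 0 :> R by rewrite pnatr_eq0.
by move=> ? ?; field; apply/andP.
Qed.

End ShiftedFactorials.

(** * Quadratic forms and Cauchy kernels *)

Section PositiveForms.
Variables (R : realType) (n : nat).
Implicit Types (K : 'I_n -> 'I_n -> R) (u v : 'I_n -> R).

Definition qform K u : R := \sum_s \sum_t u s * u t * K s t.

Definition psd K : Prop := forall u, 0 <= qform K u.

Lemma eq_psd K L : K =2 L -> psd K -> psd L.
Proof.
move=> KL pK u; have := pK u; rewrite /qform.
by under eq_bigr do under eq_bigr do rewrite KL.
Qed.

Lemma psdZ c K : 0 <= c -> psd K -> psd (fun s t => c * K s t).
Proof.
move=> c0 pK u; rewrite /qform.
under eq_bigr do (under eq_bigr do rewrite mulrCA; rewrite -mulr_sumr).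
rewrite -mulr_sumr mulr_ge0 //; exact: pK.
Qed.

Lemma qformB K u v c :
  (forall s t, K s t = K t s) ->
  qform K (fun s => u s - c * v s) =
  qform K u - 2 * c * (\sum_s \sum_t u s * v t * K s t) + c ^+ 2 * qform K v.
Proof.
move=> KC.
have E : \sum_s \sum_t v s * u t * K s t = \sum_s \sum_t u s * v t * K s t.
  rewrite exchange_big; apply: eq_bigr => s _; apply: eq_bigr => t _.
  by rewrite KC; ring.
transitivity (\sum_s \sum_t (u s * u t * K s t + (- c) * (u s * v t * K s t)
    + (- c) * (v s * u t * K s t) + c ^+ 2 * (v s * v t * K s t))).
  by apply: eq_bigr => s _; apply: eq_bigr => t _; ring.
under eq_bigr do rewrite !big_split /= -!mulr_sumr.
by rewrite !big_split /= -!mulr_sumr E /qform; ring.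
Qed.

(* The step below splits off the pivot [a], using
   1 / (x s + x t) = 2 x_a / ((x s + x_a) (x t + x_a))
     + ((x s - x_a) (x t - x_a) / ((x s + x_a) (x t + x_a))) / (x s + x t). *)
Lemma psd_cauchy (x : 'I_n -> R) K :
  (forall s, 0 < x s) -> psd K -> psd (fun s t => K s t / (x s + x t)).
Proof.
move=> x0 pK.
(* Induction on p, with [u] supported on the last p indices; the pivot [a] is the first index of the
   support, where [w] vanishes. *)
suff H p u : (forall s : 'I_n, (s + p < n)%N -> u s = 0) ->
    0 <= qform (fun s t => K s t / (x s + x t)) u.
  by move=> u; apply: (H n) => s; lia.
elim: p u => [|p IHp] u uz.
  rewrite /qform big1 // => s _; rewrite big1 // => t _.
  by rewrite uz ?mul0r // addn0.
have [np|pn] := leqP n p; first by apply: IHp => s; lia.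
have an : (n - p.+1 < n)%N by lia.
pose a := Ordinal an.
pose v s := u s / (x s + x a).
pose w s := u s * (x s - x a) / (x s + x a).
have -> : qform (fun s t => K s t / (x s + x t)) u =
    2 * x a * qform K v + qform (fun s t => K s t / (x s + x t)) w.
  rewrite /qform mulr_sumr -big_split /=; apply: eq_bigr => s _.
  rewrite mulr_sumr -big_split /=; apply: eq_bigr => t _; rewrite /v /w.
  have : x s + x a != 0 by rewrite gt_eqF // addr_gt0.
  have : x t + x a != 0 by rewrite gt_eqF // addr_gt0.
  have : x s + x t != 0 by rewrite gt_eqF // addr_gt0.
  by move=> ? ? ?; field; apply/and3P.
apply: addr_ge0; first by apply: mulr_ge0 (pK v); rewrite mulr_ge0 ?(ltW (x0 a)).
apply: IHp => s sp; rewrite /w.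
have [->|sa] := eqVneq s a; first by rewrite subrr mulr0 mul0r.
rewrite uz ?mul0r //; have : val s != val a by [].
rewrite /=; lia.
Qed.

End PositiveForms.

(** For c = 0 the form is the square of the sum of the entries of [u]. Passing from c to c + 1
    divides the kernel by i + s + t + c + 1, which is x s + x t once i + c + 1 is split into equal
    halves. *)
Lemma psd_ratf (R : realType) (n c i : nat) :
  psd (fun s t : 'I_n => ratf R c (i + s + t)).
Proof.
elim: c => [|c IHc].
  move=> u; rewrite /qform.
  under eq_bigr do under eq_bigr do rewrite /ratf addn0 divff ?factr_neq0 // mulr1.
  under eq_bigr do rewrite -mulr_sumr.
  by rewrite -mulr_suml -expr2 sqr_ge0.
pose x (s : 'I_n) : R := s%:R + (i + c.+1)%:R / 2.
have x0 s : 0 < x s by rewrite ltr_wpDl // divr_gt0 // ltr0n addnS.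
apply: eq_psd (psd_cauchy x0 IHc) => s t.
have -> : x s + x t = (i + s + t + c).+1%:R.
  by rewrite /x -addnS !natrD; field.
by rewrite /ratf addnS factS natrM invfM mulrCA mulrC.
Qed.

Lemma possemidef_hankel (R : realType) (a : nat -> R) (i r : nat) :
  possemidefmx (hankel a i r) <-> psd (fun s t : 'I_r.+1 => a (i + s + t)%N).
Proof.
have E (u : 'rV[R]_r.+1) : (u *m hankel a i r *m u^T) 0 0 =
    qform (fun s t : 'I_r.+1 => a (i + s + t)%N) (u 0).
  rewrite mxE /qform exchange_big; apply: eq_bigr => t _.
  rewrite !mxE mulr_suml; apply: eq_bigr => s _.
  by rewrite !mxE; ring.
split=> [[_ H] u|H].
  have := H (\row_s u s); rewrite E /qform.
  by under eq_bigr do under eq_bigr do rewrite !mxE.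
split=> [|u]; last by rewrite E.
by apply/matrixP => s t; rewrite !mxE addnAC.
Qed.

(** * Moments and positivity of the perturbed shift, with d = j - 1 *)

Section PerturbedAgler.
Variables (R : realType) (d : nat) (x : R).
Hypotheses (hj : (1 <= d.+1)%N) (hx : 0 < x).

(** Every moment with n >= 1 contains the squared zeroth weight once, hence the factor x; the point
    mass at 0 restores the zeroth moment 1. *)
Lemma moment_agler_pert n : moment (agler_pert hj hx) n =
  x * (d`!%:R * ratf R d n) + (1 - x) * (n == 0%N)%:R.
Proof.
have d0 := factr_neq0 R d.
case: n => [|n].
  by rewrite /moment big_ord0 /ratf fact0 add0n eqxx mulr1 mul1r divff // mulr1; ring.
rewrite mulr0 addr0; elim: n => [|n IHn].
  rewrite /moment big_ord1 /= sqr_sqrtr; last by rewrite divr_ge0 // ltW.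
  rewrite /ratf add1n !factS !natrM fact0.
  have : d.+1%:R != 0 :> R by rewrite pnatr_eq0.
  by move=> ?; field; apply/andP.
rewrite /moment big_ord_recr /= -/(moment (agler_pert hj hx) n.+1) IHn.
rewrite /agler_weight sqr_sqrtr ?divr_ge0 //.
by rewrite (ratfS _ _ n.+1) addnS -mulrA -mulrA (mulrC (ratf _ _ _)).
Qed.

(** The q-th difference of the moments of the unperturbed shift, called h in the overview. *)
Definition diff_agler q n : R := d`!%:R * rise R d q * ratf R (d + q) n.

Lemma iter_nabla_agler_pert q n :
  iter q (@nabla R) (moment (agler_pert hj hx)) n =
  x * diff_agler q n + (1 - x) * (n == 0%N)%:R.
Proof.
rewrite (eq_iter_nabla q moment_agler_pert) iter_nablaD !iter_nablaZ.
rewrite iter_nabla_ratf /diff_agler -(mulrA d`!%:R); congr (_ + _ * _).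
(* [nabla] fixes the sequence 1, 0, 0, ... *)
by elim: q n => // q IHq [|n] /=; rewrite /nabla !IHq ?subr0 ?subrr.
Qed.

Lemma diff_agler_ge0 q n : 0 <= diff_agler q n.
Proof. by rewrite !mulr_ge0 ?rise_ge0 // invr_ge0. Qed.

Lemma diff_agler0 q : (d + q)%:R * diff_agler q 0 = d%:R.
Proof.
rewrite /diff_agler /ratf fact0 add0n mul1r mulrA [_ * (d`!%:R * _)]mulrC.
by rewrite fact_rise mulfK ?factr_neq0.
Qed.

Lemma contractive_agler_pert q : (0 < q)%N ->
  contractive q (agler_pert hj hx) <-> x * q%:R <= q%:R + d%:R.
Proof.
move=> q0; have dq : 0 < (d + q)%:R :> R by rewrite ltr0n addn_gt0 q0 orbT.
have -> : (x * q%:R <= q%:R + d%:R) = (0 <= x * diff_agler q 0 + (1 - x)).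
  rewrite -(pmulr_rge0 _ dq) mulrDr mulrCA diff_agler0 natrD -subr_ge0.
  by congr (_ <= _); ring.
rewrite /contractive; split=> [/(_ 0%N)|H l].
  by rewrite -iter_nablaE iter_nabla_agler_pert mulr1.
rewrite -iter_nablaE iter_nabla_agler_pert.
case: l => [|l]; first by rewrite mulr1.
by rewrite mulr0 addr0 mulr_ge0 ?diff_agler_ge0 // ltW.
Qed.

Lemma psd_diff_agler q r i : psd (fun s t : 'I_r.+1 => diff_agler q (i + s + t)).
Proof.
have c0 : 0 <= d`!%:R * rise R d q by rewrite mulr_ge0 ?rise_ge0.
exact: (psdZ c0 (@psd_ratf R r.+1 (d + q) i)).
Qed.

Lemma repw_diff_agler q r (s : 'I_r.+1) :
  \sum_(t < r.+1) repw R (d + q) r t * diff_agler q (s + t) =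
  (s == ord0)%:R * d%:R.
Proof.
have -> : (s == ord0) = (s == 0%N :> nat) by [].
under eq_bigr do rewrite /diff_agler mulrCA.
rewrite -mulr_sumr repw_ratf; last by rewrite -ltnS.
rewrite mulrCA; congr (_ * _).
(* [E2] reduces the constant to d! [rise d q] (d + q) / (d + q)!, and [E1] reduces this to d. *)
have E1 := fact_rise R d q; have E2 := fact_rise R (d + q) r.
apply: (mulfI (factr_neq0 R (d + q + r))).
apply: (mulfI (factr_neq0 R (d + q))).
have F := factr_neq0 R (d + q + r).
transitivity (d`!%:R * rise R d q * ((d + q)`!%:R * rise R (d + q) r * (d + q + r)%:R)).
  by rewrite [(r + _)%N]addnC; field.
by rewrite E2 mulrA E1; ring.
Qed.

Lemma kPD_agler_pert k m : (m <= k)%N -> (0 < k)%N ->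
  kPD k m (agler_pert hj hx) <->
  (x - 1) * ((k - m).+1%:R * (k - m + (d + 2 * m))%:R) <= x * d%:R.
Proof.
move=> mk k0; rewrite /kPD; set q := (2 * m)%N; set r := (k - m)%N.
pose K : R := r.+1%:R * (r + (d + q))%:R; rewrite -/K.
have K0 : 0 < K.
  by rewrite /K -natrM ltr0n muln_gt0 /= /q /r; lia.
pose h (s t : 'I_r.+1) := diff_agler q (0 + s + t).
pose w (t : 'I_r.+1) := repw R (d + q) r t.
have qE u : qform (fun s t : 'I_r.+1 =>
      iter q (@nabla R) (moment (agler_pert hj hx)) (0 + s + t)%N) u =
    x * qform h u + (1 - x) * u ord0 ^+ 2.
  rewrite /qform.
  under eq_bigr do (under eq_bigr do
    rewrite iter_nabla_agler_pert mulrDr (mulrCA _ x); rewrite big_split /= -mulr_sumr).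
  rewrite big_split /= -mulr_sumr; congr (_ + _).
  rewrite (bigD1 ord0) //= [X in _ + X]big1 => [|s s0]; last first.
    by rewrite big1 // => t _; rewrite add0n addn_eq0 (negbTE (s0 : s != 0%N :> nat)) /= !mulr0.
  rewrite addr0 (bigD1 ord0) //= big1 => [|t t0]; last first.
    by rewrite add0n addn_eq0 (negbTE (t0 : t != 0%N :> nat)) /= !mulr0.
  by rewrite addr0; ring.
have hw s : \sum_t w t * h s t = (s == ord0)%:R * d%:R.
  by rewrite -(repw_diff_agler q); apply: eq_bigr => t _.
have huw u : \sum_s \sum_t u s * w t * h s t = u ord0 * d%:R.
  under eq_bigr do (under eq_bigr do rewrite -mulrA; rewrite -mulr_sumr hw).
  rewrite (bigD1 ord0) //= big1 ?addr0 ?mul1r // => s /negbTE ->.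
  by rewrite mul0r mulr0.
have hC s t : h s t = h t s by rewrite /h addnAC.
have w0 : w ord0 = K by rewrite /w /= repw0.
have ph : psd h by exact: psd_diff_agler.
(* Necessity: at [w] the form of [h] equals K d, so the whole form is K (x d - (x - 1) K). *)
split=> [/(_ 0%N) /possemidef_hankel /(_ w)|H i].
  rewrite qE {1}/qform huw w0 => H; rewrite -subr_ge0 -(pmulr_lge0 _ K0).
  by apply: le_trans H _; rewrite le_eqVlt; apply/orP; left; apply/eqP; ring.
apply/possemidef_hankel; case: i => [|i].
  move=> u; rewrite qE.
  (* The coefficient u_0 / K cancels the entry at 0; the form of [h] at the resulting vector is u^T
     h u - d u_0^2 / K. *)
  have Q : d%:R * u ord0 ^+ 2 <= K * qform h u.
    have := ph (fun s => u s - u ord0 / K * w s).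
    rewrite qformB //.
    rewrite huw {2}/qform huw w0 => H1; rewrite -subr_ge0.
    have := mulr_ge0 (ltW K0) H1; congr (_ <= _); field.
    by rewrite gt_eqF.
  rewrite -(pmulr_rge0 _ K0).
  have H2 : 0 <= (x * d%:R - (x - 1) * K) * u ord0 ^+ 2.
    by rewrite mulr_ge0 ?sqr_ge0 // subr_ge0.
  apply: le_trans H2 _.
  have := ler_wpM2l (ltW hx) Q; lra.
apply: (eq_psd _ (psdZ (ltW hx) (@psd_diff_agler q r i.+1))) => s t.
by rewrite iter_nabla_agler_pert mulr0 addr0.
Qed.

End PerturbedAgler.

(** * The bound and the order of contractivity *)

Theorem theorem1p5 (R : realType) (j : nat) (hj : (1 <= j)%N)
    (x : R) (hx : 0 < x) (k m : nat) (hk : (1 <= k)%N) (hm : (m <= k)%N) :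
  (kPD k m (agler_pert hj hx) <-> x <= pbound R j k m) /\
  pbound R j k m =
    ((j%:R + k%:R + m%:R) * (k%:R - m%:R) + 2 * m%:R + j%:R - 1) /
    ((j%:R + k%:R + m%:R) * (k%:R - m%:R) + 2 * m%:R) /\
  (kPD k m (agler_pert hj hx) <->
   contractive ((j + k + m) * (k - m) + 2 * m) (agler_pert hj hx)).
Proof.
case: j hj => [//|d] hj.
set N := (X in contractive X).
have N0 : (0 < N)%N by rewrite /N; nia.
have NE : N%:R = (d.+1%:R + k%:R + m%:R) * (k%:R - m%:R) + 2 * m%:R :> R.
  by rewrite /N natrD !natrM natrB // !natrD.
have pE : pbound R d.+1 k m = (N%:R + d%:R) / N%:R.
  by rewrite /pbound NE -natr1; congr (_ / _); ring.
have pN : (x <= pbound R d.+1 k m) = (x * N%:R <= N%:R + d%:R).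
  by rewrite pE ler_pdivlMr // ltr0n.
have PD : kPD k m (agler_pert hj hx) <-> x * N%:R <= N%:R + d%:R.
  (* With K = (k - m + 1) (k + m + d) one has K = N + d, so the two inequalities have the same
     difference of sides. *)
  have -> : (x * N%:R <= N%:R + d%:R) =
    ((x - 1) * ((k - m).+1%:R * (k - m + (d + 2 * m))%:R) <= x * d%:R).
    rewrite -subr_ge0 -[RHS]subr_ge0 NE natrD natrD natrM.
    rewrite -[(k - m).+1%:R]natr1 -[d.+1%:R]natr1 natrB //.
    by congr (_ <= _); ring.
  exact: kPD_agler_pert.
split; first by rewrite pN.
split; first by rewrite pE NE -natr1; congr (_ / _); ring.
by apply: iff_trans PD (iff_sym _); exact: contractive_agler_pert.
Qed.
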